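(* For every non-trivial simple connected graph $G=(V,E)$ of order $n$ (so $n\ge 2$) and diameter $d$ such that $\dim(G)<f'(n,d)$, $$\dim_{ms}(G)>\dim(G).$$
   Context: For positive integers $n,d$, $f'(n,d)$ denotes the smallest positive integer $k'$ such that $k'+\binom{k'+d-1}{d-1}\ge n$. Graphs are finite, simple and connected; $d_G(u,v)$ is the length of a shortest $u$–$v$ path. For $S=\{w_1,\ldots,w_t\}\subseteq V$ and $u\in V$, the multiset representation of $u$ with respect to $S$ is the multiset $\operatorname{m}(u|S)$ consisting of $d_G(u,w_1),\ldots,d_G(u,w_t)$, counted with multiplicity, and the metric representation of $u$ (with $S$ ordered) is the vector $\operatorname{r}(u|S)=(d_G(u,w_1),\ldots,d_G(u,w_t))$. A set $S$ is an outer multiset resolving set if $\operatorname{m}(u|S)\ne \operatorname{m}(v|S)$ for every two distinct $u,v\in V\setminus S$; the outer multiset dimension $\dim_{ms}(G)$ is the minimum cardinality of such a set. A set $S$ is a resolving set if $\operatorname{r}(u|S)\neq \operatorname{r}(v|S)$ for every two distinct $u,v\in V$; the metric dimension $\dim(G)$ is the minimum cardinality of a resolving set. *)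

(* Defs.v *)
From mathcomp Require Import all_boot.
From mathcomp Require Import finmap multiset.

Set Implicit Arguments.
Unset Strict Implicit.
Unset Printing Implicit Defensive.

Record cgraph := CGraph {
  vertex :> finType;
  adj : rel vertex;
  adj_sym : symmetric adj;
  adj_irr : irreflexive adj;
  adj_connected : forall u v : vertex, connect adj u v
}.

Section Graph.
Variable G : cgraph.

Definition path_of_length (u v : G) (k : nat) : bool :=
  [exists p : k.-tuple G,
    [&& path (@adj G) u p, uniq (u :: p) & last u p == v]].

Lemma ex_path_of_length (u v : G) : exists k, path_of_length u v k.
Proof.
have /connectP [p up ->] := adj_connected u v.
have [q uq uniq_q _] := shortenP up.
exists (size q); apply/existsP; exists (in_tuple q).
by rewrite /= uq eqxx andbT; exact: uniq_q.
Qed.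

Definition dist (u v : G) : nat := ex_minn (ex_path_of_length u v).

Definition diam : nat := \max_(u : G) \max_(v : G) dist u v.

(* The vertices of S are listed in the fixed order of enum S. *)
Definition metric_rep (u : G) (S : {set G}) : seq nat :=
  [seq dist u w | w <- enum S].

Definition multiset_rep (u : G) (S : {set G}) : {mset nat}%mset :=
  seq_mset [seq dist u w | w <- enum S].

Definition resolving (S : {set G}) : bool :=
  [forall u : G, forall v : G,
    (u != v) ==> (metric_rep u S != metric_rep v S)].

Definition outer_multiset_resolving (S : {set G}) : bool :=
  [forall u in ~: S, forall v in ~: S,
    (u != v) ==> (multiset_rep u S != multiset_rep v S)].

Lemma ex_resolving : exists k, [exists S : {set G}, resolving S && (#|S| == k)].
Proof.
exists #|[set: G]|; apply/existsP; exists [set: G]; rewrite eqxx andbT.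
apply/forallP => u; apply/forallP => v; apply/implyP => /eqP neq_uv.
apply/eqP => /eq_in_map eq_uv; apply: neq_uv.
have dist_uu : dist u u = 0.
  rewrite /dist; case: ex_minnP => k _ min_k; apply/eqP; rewrite -leqn0.
  by apply: min_k; apply/existsP; exists [tuple]; rewrite /= eqxx.
have := eq_uv u; rewrite mem_enum in_setT dist_uu => /(_ isT).
rewrite /dist; case: ex_minnP => k /existsP [p /and3P [_ _ /eqP <-]] _ k0.
by case: p => -[|x p] //= /eqP sz; rewrite -sz in k0.
Qed.

Lemma ex_outer_multiset_resolving :
  exists k, [exists S : {set G}, outer_multiset_resolving S && (#|S| == k)].
Proof.
exists #|[set: G]|; apply/existsP; exists [set: G]; rewrite eqxx andbT.
by apply/forallP => u; rewrite setCT in_set0.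
Qed.

Definition metric_dim : nat := ex_minn ex_resolving.

Definition outer_multiset_dim : nat := ex_minn ex_outer_multiset_resolving.

End Graph.

Lemma ex_f' (n d : nat) : exists k, (0 < k) && (n <= k + 'C(k + d - 1, d - 1)).
Proof. by exists n.+1; rewrite /= addSn ltnW // ltnS leq_addr. Qed.

(* Meaningful for n, d > 0 only: for d = 0 the subtraction d - 1 truncates. *)
Definition f' (n d : nat) : nat := ex_minn (ex_f' n d).

(* Main.v *)
Require Import Defs.
From mathcomp Require Import all_boot.
From mathcomp Require Import finmap multiset.

Set Implicit Arguments.
Unset Strict Implicit.
Unset Printing Implicit Defensive.

(** A vertex outside [S] has all its distances to [S] in [1 .. d], so there are
    at most ['C(k + d - 1, d - 1)] multiset representations when [#|S| = k].
    If [S] is outer multiset resolving, this forces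
    [n <= k + 'C(k + d - 1, d - 1)], and hence [f' n d <= k]. *)

Section Distances.
Variable G : cgraph.

Lemma dist_gt0 (u v : G) : u != v -> 0 < dist u v.
Proof.
move=> neq_uv; rewrite /dist; case: ex_minnP => -[|k] // /existsP [p].
by rewrite tuple0 /= (negPf neq_uv).
Qed.

Lemma dist_le_diam (u v : G) : dist u v <= diam G.
Proof.
by apply: (@bigmax_sup _ u) => //; apply: (@bigmax_sup _ v).
Qed.

Lemma diam_gt0 : 1 < #|G| -> 0 < diam G.
Proof.
case/card_gt1P => u [v [_ _ neq_uv]].
exact: leq_trans (dist_gt0 neq_uv) (dist_le_diam u v).
Qed.

(* Distances are shifted down by one, so that the [diam G] values possible
   outside [S] fill the type ['I_(diam G).-1.+1]. *)
Definition shifted_dists (S : {set G}) (u : G) : seq 'I_(diam G).-1.+1 :=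
  [seq inord (dist u w).-1 | w <- enum S].

Lemma shifted_distsK (S : {set G}) (u : G) : u \notin S ->
  [seq (val i).+1 | i <- shifted_dists S u] = [seq dist u w | w <- enum S].
Proof.
move=> uNS; rewrite -map_comp; apply/eq_in_map => w; rewrite mem_enum => wS /=.
have d_gt0 : 0 < dist u w by apply: dist_gt0; apply: contraNneq uNS => ->.
have le_d := dist_le_diam u w.
by rewrite inordK ?prednK // (leq_trans d_gt0).
Qed.

(** Spelled with [relpre] so that [sort_map] can carry the sorting over to the underlying
    naturals. *)
Definition val_leq := relpre (fun i : 'I_(diam G).-1.+1 => val i) leq.

Lemma size_sorted_dists (S : {set G}) (u : G) :
  size (sort val_leq (shifted_dists S u)) == #|S|.
Proof. by rewrite size_sort size_map -cardE. Qed.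

Definition sorted_dists (S : {set G}) (u : G) : #|S|.-tuple 'I_(diam G).-1.+1 :=
  Tuple (size_sorted_dists S u).

(** Equal sorted tuples come from shifted distance lists that are permutations of each other;
    undoing the shift, valid outside [S], gives equal multisets. *)
Lemma sorted_dists_inj (S : {set G}) :
  outer_multiset_resolving S -> {in ~: S &, injective (sorted_dists S)}.
Proof.
move=> resS u v uS vS /(congr1 val) /= eq_uv; apply/eqP.
move/forall_inP/(_ u uS)/forall_inP/(_ v vS): resS.
apply: contraTT => ->; rewrite negbK; apply/eqP/eq_seq_msetP.
rewrite !in_setC in uS vS; rewrite -(shifted_distsK uS) -(shifted_distsK vS).
by apply: perm_map; rewrite -(perm_sort val_leq) eq_uv perm_sort.
Qed.

Lemma card_outer_multiset_resolving (S : {set G}) :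
  0 < diam G -> outer_multiset_resolving S ->
  #|G| <= #|S| + 'C(#|S| + diam G - 1, diam G - 1).
Proof.
move=> d_gt0 resS; rewrite -(cardsC S) leq_add2l -addnBA // subn1.
(* By symmetry the binomial counts the nondecreasing [#|S|]-tuples over [diam G] values. *)
rewrite -bin_sub ?leq_addl // addnK -card_sorted_tuples.
rewrite -(card_in_imset (sorted_dists_inj resS)).
apply/subset_leq_card/subsetP => _ /imsetP [u _ ->]; rewrite inE /=.
by rewrite -sort_map sort_sorted //; exact: leq_total.
Qed.

Lemma f'_le_outer_multiset_dim :
  1 < #|G| -> f' #|G| (diam G) <= outer_multiset_dim G.
Proof.
move=> n_gt1; rewrite /outer_multiset_dim.
case: ex_minnP => k /existsP [S /andP [resS /eqP <-]] _.
have le_n := card_outer_multiset_resolving (diam_gt0 n_gt1) resS.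
rewrite /f'; case: ex_minnP => m _; apply; rewrite le_n andbT lt0n.
(* [f'] ranges over positive integers only, so [S] must be nonempty: an empty [S] would give
   [#|G| <= 0 + 1]. *)
apply: contraTneq le_n => ->.
by rewrite !add0n binn -ltnNge.
Qed.

End Distances.

Theorem theorem3p6 (G : cgraph) (n d : nat)
  (order_G : #|G| = n) (n_ge2 : 2 <= n) (diam_G : diam G = d)
  (dim_lt : metric_dim G < f' n d) :
  outer_multiset_dim G > metric_dim G.
Proof.
subst n d; exact: leq_trans dim_lt (f'_le_outer_multiset_dim n_ge2).
Qed.
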